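(* Let $G=(V,E)$ be a finite simple undirected graph, $\ell:E\to\mathbb{R}_{\ge 0}$ a length function, $s,t\in V$, and $d\in\mathbb{R}$. Then the number of orientations of $G$ in which the (directed) distance from $s$ to $t$ is at most $d$ equals the number of subsets $X\subseteq E$ such that in the undirected graph $(V,X)$ the distance from $s$ to $t$ is at most $d$.
   Context: Distances are computed with respect to the edge lengths $\ell$: in a digraph as the minimum length of a directed $s$-$t$ path, in an undirected graph as the minimum length of an $s$-$t$ path (edges usable in either direction); the distance is $+\infty$ if no path exists. An orientation of $G$ assigns a direction to each edge. *)

(* Defs.v *)
From HB Require Import structures.
From mathcomp Require Import all_boot all_order all_algebra.
From mathcomp Require Import reals constructive_ereal.

Set Implicit Arguments.
Unset Strict Implicit.
Unset Printing Implicit Defensive.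

Import Order.TTheory GRing.Theory Num.Theory.
Local Open Scope ring_scope.

(* A simple graph on the vertex type T is given by its set E of edges, each edge
   being the unordered pair [set u; v] of its two distinct endpoints. *)
Definition simple_edges (T : finType) (E : {set {set T}}) : bool :=
  [forall e in E, #|e| == 2].

Definition edge_rel (T : finType) (X : {set {set T}}) : rel T :=
  fun u v => [set u; v] \in X.

Definition arc_rel (T : finType) (D : {set T * T}) : rel T :=
  fun u v => (u, v) \in D.

(* An orientation of E is represented by its set of arcs: every arc lies over
   an edge of E, and every edge uv contributes exactly one of (u, v), (v, u). *)
Definition orientation (T : finType) (E : {set {set T}}) (D : {set T * T})
    : bool :=
  [forall u, forall v,
    if [set u; v] \in E then ((u, v) \in D) (+) ((v, u) \in D)
    else (u, v) \notin D].

(* As in path.v, the vertex sequence of a path is s :: p. *)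
Definition path_length (R : realType) (T : finType) (l : {set T} -> R)
    (s : T) (p : seq T) : R :=
  \sum_(x <- pairmap (fun u v => l [set u; v]) s p) x.

Definition is_st_path (T : finType) (r : rel T) (s t : T) (p : seq T) : bool :=
  [&& path r s p, uniq (s :: p) & last s p == t].

(* A path has no repeated vertex, hence fewer than #|T| edges, so the outer
   minimum over the number k of edges covers all s-t paths. *)
Definition dist (R : realType) (T : finType) (l : {set T} -> R) (r : rel T)
    (s t : T) : \bar R :=
  \big[Order.min/+oo%E]_(k < #|T|)
    \big[Order.min/+oo%E]_(p : k.-tuple T | is_st_path r s t p)
      (path_length l s p)%:E.

(* Main.v *)
(** An s-t path that uses an arc uv and one that uses the reverse arc vu, both
    of length at most d, can be recombined at u and v into two s-t walks that
    use neither arc, one of which again has length at most d.  Hence, whatever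
    the other arcs are, presenting the edge uv as a random one of the two arcs
    or as a random one of "none" and "both" gives equally many good outcomes.
    Replacing the edges one by one turns orientations into edge subsets. *)
Require Import Defs.
From HB Require Import structures.
From mathcomp Require Import all_boot all_order all_algebra.
From mathcomp Require Import reals constructive_ereal lra.

Import Order.TTheory GRing.Theory Num.Theory.
Local Open Scope ring_scope.

(** * Bounded distance as existence of a short path *)

Lemma dist_leP (R : realType) (T : finType) (l : {set T} -> R) (r : rel T)
    (s t : T) (d : R) :
  reflect (exists2 p, is_st_path r s t p & path_length l s p <= d)
    (dist l r s t <= d%:E)%E.
Proof.
apply: (iffP idP) => [/boolp.bigmin_leP[|[k _]]|[p pP le_pd]].
(* The default [+oo] of the minimum is never at most the real [d]. *)
- by rewrite leye_eq.
- case/boolp.bigmin_leP=> [|[p pP le_pd]]; first by rewrite leye_eq.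
  by exists p.
have sz : (size p < #|T|)%N.
  by case/and3P: pP => _ /card_uniqP /= <- _; apply: max_card.
apply/boolp.bigmin_leP; right; exists (Ordinal sz) => //.
by apply/boolp.bigmin_leP; right; exists (in_tuple p).
Qed.

Lemma path_length_cons (R : realType) (T : finType) (l : {set T} -> R)
    (s x : T) (p : seq T) :
  path_length l s (x :: p) = l [set s; x] + path_length l x p.
Proof. by rewrite /path_length /= big_cons. Qed.

Lemma path_length_cat (R : realType) (T : finType) (l : {set T} -> R)
    (s : T) (p q : seq T) :
  path_length l s (p ++ q) = path_length l s p + path_length l (last s p) q.
Proof. by rewrite /path_length pairmap_cat big_cat. Qed.

(** Allows lengths to be changed off the edges, and an undirected graph to be replaced by a
    digraph. *)
Lemma dist_eq (R : realType) (T : finType) (l l' : {set T} -> R) (r r' : rel T)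
    (s t : T) :
    r =2 r' -> (forall u v, r u v -> l [set u; v] = l' [set u; v]) ->
  dist l r s t = dist l' r' s t.
Proof.
move=> rr' ll'; apply: eq_bigr => k _; apply: eq_big => [p|p /and3P[+ _ _]].
  by rewrite /is_st_path (eq_path rr').
move=> rp; congr (_%:E).
elim: (tval p) s rp => [|x q IH] s; first by rewrite /path_length !big_nil.
by move=> /= /andP[rsx rq]; rewrite !path_length_cons ll' // IH.
Qed.

(** * Walks under nonnegative lengths, and the exchange at one edge *)

Section NonnegativeLengths.

Variables (R : realType) (T : finType) (l : {set T} -> R).
Hypothesis l_ge0 : forall e, 0 <= l e.

Lemma path_length_ge0 (s : T) (p : seq T) : 0 <= path_length l s p.
Proof.
elim: p s => [|x p IH] s; first by rewrite /path_length big_nil.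
by rewrite path_length_cons addr_ge0.
Qed.

(** Induction on the walk: if [s] recurs on the path found for the tail, everything before that
    occurrence is dropped, which cannot increase the length. *)
Lemma walk_to_path (r : rel T) (s : T) (p : seq T) : path r s p ->
  exists2 q, is_st_path r s (last s p) q &
    path_length l s q <= path_length l s p.
Proof.
elim: p s => [|x p IH] s /=.
  by exists [::]; rewrite // /is_st_path /= eqxx.
case/andP=> rsx /IH[q /and3P[rq uq lq] le_q].
have le_xq : path_length l s (x :: q) <= path_length l s (x :: p).
  by rewrite !path_length_cons lerD2l.
have [s_in|s_out] := boolP (s \in x :: q); last first.
  by exists (x :: q) => //; apply/and3P; split; rewrite //= ?rsx ?s_out.
case: (s =P x) => [->|/eqP neq_sx].
  exists q; first by apply/and3P.
  by apply: le_trans le_q _; rewrite path_length_cons lerDr.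
move: s_in; rewrite inE (negPf neq_sx) /= => /splitPr qE.
case: qE rq uq lq le_q {le_xq} => q1 q2.
rewrite -cat_cons cat_uniq cat_path last_cat => /and3P[_ _ rq2] /and3P[_ _ uq2].
move=> lq le_q; exists q2; first by apply/and3P.
apply: le_trans (le_trans le_q _); last by rewrite path_length_cons lerDr.
rewrite path_length_cat path_length_cons addrA lerDr.
by rewrite addr_ge0 ?path_length_ge0.
Qed.

(** Frees the concatenations below from any check for repeated vertices. *)
Lemma dist_le_walkP (r : rel T) (s t : T) (d : R) :
  reflect (exists p, [/\ path r s p, last s p = t & path_length l s p <= d])
    (dist l r s t <= d%:E)%E.
Proof.
apply: (iffP (dist_leP _ _ _ _ _ _ _)) =>
  [[p /and3P[rp _ /eqP lp] le_p]|[p [rp lp le_p]]].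
  by exists p.
have [q qP le_q] := walk_to_path _ _ _ rp.
by exists q; [rewrite -lp | apply: le_trans le_q le_p].
Qed.

(* Cut the walk before the first and after the last occurrence of the arc. *)
Lemma walk_split_arc (D : {set T * T}) (u v s : T) (p : seq T) :
    path (arc_rel ((u, v) |: D)) s p ->
  path (arc_rel D) s p \/
  exists p1 p2, [/\ path (arc_rel D) s p1, last s p1 = u,
    path (arc_rel D) v p2, last v p2 = last s p &
    path_length l s p1 + (l [set u; v] + path_length l v p2)
      <= path_length l s p].
Proof.
elim: p s => [|x p IH] s /=; first by left.
have len0 y : path_length l y [::] = 0 by rewrite /path_length big_nil.
rewrite {1}/arc_rel !inE => /andP[/orP[/eqP[-> ->]|Dsx] /IH[Dp|]].
- right; exists [::], p; split => //.
  by rewrite len0 add0r path_length_cons.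
(* The arc comes first and recurs: the empty prefix stops at its first occurrence, [p2] starts after
   its last, and the part skipped has nonnegative length. *)
- case=> p1 [p2 [_ _ Dp2 lp2 le_p]]; right; exists [::], p2; split => //.
  rewrite len0 add0r path_length_cons.
  move: le_p; have := path_length_ge0 v p1; have := l_ge0 [set u; v]; lra.
- by left; rewrite /arc_rel Dsx.
case=> p1 [p2 [Dp1 lp1 Dp2 lp2 le_p]]; right; exists (x :: p1), p2.
by split; rewrite //= ?[arc_rel _ _ _]Dsx // !path_length_cons -addrA lerD2l.
Qed.

Lemma dist_le_subset (D D' : {set T * T}) (s t : T) (d : R) : D \subset D' ->
  (dist l (arc_rel D) s t <= d%:E)%E -> (dist l (arc_rel D') s t <= d%:E)%E.
Proof.
move=> /subsetP sDD' /dist_le_walkP[p [Dp lp le_p]]; apply/dist_le_walkP.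
by exists p; split=> //; apply: sub_path Dp => x y; apply: sDD'.
Qed.

(** If the walks are [p1], [(u, v)], [p2] and [q1], [(v, u)], [q2], then [p1 ++ q2] meets at [u] and
    [q1 ++ p2] at [v]. Their lengths sum to at most [2 d], so one of them is at most [d]. *)
Lemma dist_le_arcI (D : {set T * T}) (u v s t : T) (d : R) :
    (dist l (arc_rel ((u, v) |: D)) s t <= d%:E)%E ->
    (dist l (arc_rel ((v, u) |: D)) s t <= d%:E)%E ->
  (dist l (arc_rel D) s t <= d%:E)%E.
Proof.
case/dist_le_walkP=> p [/walk_split_arc[Dp lp le_p _|]].
  by apply/dist_le_walkP; exists p.
case=> p1 [p2 [Dp1 lp1 Dp2 lp2 le_p]] lp le_pd.
case/dist_le_walkP=> q [/walk_split_arc[Dq lq le_q|]].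
  by apply/dist_le_walkP; exists q.
case=> q1 [q2 [Dq1 lq1 Dq2 lq2 le_q]] lq le_qd; apply/dist_le_walkP.
have [le1|gt1] := leP (path_length l s (p1 ++ q2)) d.
  by exists (p1 ++ q2); rewrite cat_path last_cat lp1 Dp1 Dq2 lq2.
exists (q1 ++ p2); rewrite cat_path last_cat lq1 Dq1 Dp2 lp2; split=> //.
move: gt1; rewrite !path_length_cat lp1 lq1.
by have := l_ge0 [set u; v]; have := l_ge0 [set v; u]; lra.
Qed.

(** Using both arcs is a detour. Cut at [(v, u)]: if [(u, v)] occurs before, the walk returns to
    [u]; if after, it returns to [v]. Skipping the closed part leaves at most one of the two arcs in
    use. *)
Lemma dist_le_arcU (D : {set T * T}) (u v s t : T) (d : R) :
    (dist l (arc_rel ((v, u) |: ((u, v) |: D))) s t <= d%:E)%E ->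
  (dist l (arc_rel ((u, v) |: D)) s t <= d%:E)%E \/
  (dist l (arc_rel ((v, u) |: D)) s t <= d%:E)%E.
Proof.
case/dist_le_walkP=> p [/walk_split_arc[Dp lp le_p|]].
  by left; apply/dist_le_walkP; exists p.
case=> p1 [p2 [Dp1 lp1 Dp2 lp2 le_p]] lp le_pd.
have cat_ok D' w q1 q2 : path (arc_rel D') s q1 -> last s q1 = w ->
    path (arc_rel D') w q2 -> last w q2 = t ->
    path_length l s q1 + path_length l w q2 <= d ->
  (dist l (arc_rel D') s t <= d%:E)%E.
  move=> Dq1 lq1 Dq2 lq2 le_q; apply/dist_le_walkP; exists (q1 ++ q2).
  by rewrite cat_path last_cat path_length_cat lq1 Dq1 Dq2.
have [Dp1'|[q1 [q2 [Dq1 lq1 Dq2 lq2 le_q]]]] := walk_split_arc _ _ _ _ _ Dp1;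
  last first.
  left; apply: (cat_ok _ u q1 p2); rewrite ?lp2 //.
    by apply: sub_path Dq1 => x y; rewrite /arc_rel !inE orbC => ->.
  move: (path_length_ge0 v q2) (l_ge0 [set u; v]) (l_ge0 [set v; u]); lra.
have sub_vu q x : path (arc_rel D) x q -> path (arc_rel ((v, u) |: D)) x q.
  by apply: sub_path => y z; rewrite /arc_rel !inE orbC => ->.
right.
have [Dp2'|[q1 [q2 [Dq1 lq1 Dq2 lq2 le_q]]]] := walk_split_arc _ _ _ _ _ Dp2.
  apply: (cat_ok _ v p1 (u :: p2)) => //=.
  - exact: sub_vu.
  - by rewrite [arc_rel _ _ _]setU11 sub_vu.
  - by rewrite lp2.
  by rewrite path_length_cons (le_trans le_p).
(* [p1] ends at [v], where [q2] starts after the last [(u, v)]. *)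
apply: (cat_ok _ v p1 q2); rewrite ?lq2 ?lp2 //; try exact: sub_vu.
move: (path_length_ge0 u q1) (l_ge0 [set u; v]) (l_ge0 [set v; u]); lra.
Qed.

(** With [a] and [b] the outcomes for the single arcs, no arc gives [a && b] and both arcs give
    [a || b]; as numbers these add up to [a + b]. *)
Lemma dist_le_arc_modular (D : {set T * T}) (u v s t : T) (d : R) :
  let f D := (dist l (arc_rel D) s t <= d%:E)%E in
  (f D + f ((v, u) |: ((u, v) |: D)) =
    f ((u, v) |: D) + f ((v, u) |: D))%N.
Proof.
move=> f.
have fS (A B : {set T * T}) : A \subset B -> f A -> f B.
  exact: dist_le_subset.
have -> : f D = f ((u, v) |: D) && f ((v, u) |: D).
  apply/idP/andP => [fD|[]]; last exact: dist_le_arcI.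
  by split; apply: fS fD; apply: subsetUr.
have -> : f ((v, u) |: ((u, v) |: D)) = f ((u, v) |: D) || f ((v, u) |: D).
  apply/idP/orP => [|[]]; first exact: dist_le_arcU.
    exact/fS/subsetUr.
  exact/fS/setUS/subsetUr.
by case: (f ((u, v) |: D)) (f ((v, u) |: D)) => [] [].
Qed.

End NonnegativeLengths.

(** * Splitting off one edge from orientations and from edge subsets *)

Lemma eq_set2 (T : finType) (x y u v : T) : u != v ->
  ([set x; y] == [set u; v]) = ((x, y) == (u, v)) || ((x, y) == (v, u)).
Proof.
move=> neq_uv; rewrite !xpair_eqE.
apply/eqP/orP => [exy|[|] /andP[/eqP-> /eqP->] //]; last exact: setUC.
have := set21 u v; have := set22 u v; rewrite -{1 2}exy !inE.
have := set21 x y; have := set22 x y; rewrite exy !inE.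
move=> /orP[] /eqP-> /orP[] /eqP->; rewrite ?eqxx ?orbb => vxy uxy; auto.
  by rewrite eq_sym vxy in neq_uv.
by rewrite uxy in neq_uv.
Qed.

(** Presents an undirected graph as a digraph, so that one function of arc sets measures both sides
    of the count. *)
Definition edge_arcs (T : finType) (X : {set {set T}}) : {set T * T} :=
  [set a | [set a.1; a.2] \in X].
Arguments edge_arcs {T} X.

Lemma orientationP (T : finType) (E : {set {set T}}) (D : {set T * T}) :
  reflect (forall u v, if [set u; v] \in E
                       then ((u, v) \in D) (+) ((v, u) \in D)
                       else (u, v) \notin D)
    (orientation E D).
Proof. exact: (iffP 'forall_forallP). Qed.

(** Deleting [(u, v)] is a bijection onto the orientations of the remaining edges, with inverse
    adding it. *)
Lemma big_orientation_arc (T : finType) (E : {set {set T}})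
    (F : {set T * T} -> nat) (u v : T) : u != v -> [set u; v] \in E ->
  (\sum_(D | orientation E D && ((u, v) \in D)) F D =
   \sum_(D | orientation (E :\ [set u; v]) D) F ((u, v) |: D))%N.
Proof.
move=> neq_uv Euv.
rewrite (reindex_onto (setU [set (u, v)]) (fun D => D :\ (u, v))) /=;
  last first.
  by move=> D /andP[_]; apply: setD1K.
apply: eq_bigl => D; rewrite setU11 andbT.
have -> : (((u, v) |: D) :\ (u, v) == D) = ((u, v) \notin D).
  by apply/eqP/idP => [<-|]; [rewrite setD11 | apply: setU1K].
have neq_vu : ((v, u) == (u, v)) = false.
  by rewrite xpair_eqE [v == u]eq_sym (negPf neq_uv).
have swap x y : ((y, x) == (u, v)) = ((x, y) == (v, u)).
  by rewrite !xpair_eqE andbC.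
apply/andP/idP => [[/orientationP oD nDuv]|/orientationP oD].
  apply/orientationP => x y; rewrite !inE eq_set2 //.
  case: eqP => [[-> ->] //|/eqP/negPf nxy].
  case: eqP => [[-> ->] /=|/eqP/negPf nyx] /=.
    by have := oD u v; rewrite Euv !inE eqxx neq_vu.
  by have := oD x y; rewrite !inE (swap x y) nxy nyx.
have nDuv : (u, v) \notin D by have := oD u v; rewrite !inE eqxx.
have nDvu : (v, u) \notin D.
  by have := oD v u; rewrite !inE eq_set2 // eqxx orbT.
split=> //; apply/orientationP => x y; have := oD x y.
rewrite !inE eq_set2 // (swap x y).
case: eqP => [[-> ->]|_].
  by rewrite Euv (negPf nDvu) [_ == (v, u)]eq_sym neq_vu.
by case: eqP => [[-> ->]|_] //=; rewrite setUC Euv (negPf nDvu).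
Qed.

Lemma big_subset_setD1 (T : finType) (E : {set T}) (F : {set T} -> nat)
    (e : T) : e \in E ->
  (\sum_(X : {set T} | X \subset E) F X =
   \sum_(X : {set T} | X \subset E :\ e) (F X + F (e |: X)))%N.
Proof.
move=> Ee; rewrite big_split /= (bigID (fun X : {set T} => e \in X)) /= addnC.
congr (_ + _)%N; first by apply: eq_bigl => X; rewrite subsetD1.
rewrite (reindex_onto (fun X => e |: X) (fun X => X :\ e)) /=; last first.
  by move=> X /andP[_]; apply: setD1K.
apply: eq_bigl => X; rewrite setU11 andbT subUset sub1set Ee subsetD1 /=.
congr (_ && _); apply/eqP/idP => [<-|]; first by rewrite setD11.
exact: setU1K.
Qed.

(** * Induction on the edges and the final count *)

Lemma set0_orientation (T : finType) (D : {set T * T}) :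
  orientation set0 D = (D == set0).
Proof.
apply/orientationP/eqP => [D0|-> u v]; last by rewrite !inE.
by apply/setP=> -[u v]; have := D0 u v; rewrite !inE => /negPf.
Qed.

Lemma edge_arcsU1 (T : finType) (X : {set {set T}}) (u v : T) : u != v ->
  edge_arcs ([set u; v] |: X) = (v, u) |: ((u, v) |: edge_arcs X).
Proof.
move=> neq_uv; apply/setP=> -[x y].
by rewrite !inE /= eq_set2 // orbA [_ || (_ == (v, u))]orbC.
Qed.

(** The set [A] holds the arcs already chosen for edges removed from [E]; it must vary in the
    induction. *)
Lemma sum_orientations_subsets (T : finType) (f : {set T * T} -> bool)
    (E : {set {set T}}) (A : {set T * T}) :
    (forall D u v, f D + f ((v, u) |: ((u, v) |: D)) =
       f ((u, v) |: D) + f ((v, u) |: D))%N ->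
    simple_edges E ->
  (\sum_(D | orientation E D) f (A :|: D) =
   \sum_(X : {set {set T}} | X \subset E) f (A :|: edge_arcs X))%N.
Proof.
move=> f_mod; have [n] := ubnP #|E|.
elim: n => // n IH in E A * => ltEn simpleE.
have [E0|[e Ee]] := set_0Vmem E.
  rewrite E0 (big_pred1 set0) => [|D]; last exact: set0_orientation.
  rewrite (big_pred1 set0) => [|X]; last exact: subset0.
  by congr (f (_ :|: _)); apply/setP=> a; rewrite !inE.
have /cards2P[u [v [neq_uv eE]]] := forall_inP simpleE e Ee.
have neq_vu : v != u by rewrite eq_sym.
have Evu : [set v; u] \in E by rewrite setUC -eE.
have ltE'n : (#|E :\ e| < n)%N by rewrite (cardsD1 e E) Ee in ltEn.
have simpleE' : simple_edges (E :\ e).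
  by apply/forall_inP => x /setD1P[_]; apply: (forall_inP simpleE).
rewrite (bigID (fun D : {set T * T} => (u, v) \in D)) /=.
(* An orientation without [(u, v)] is one with [(v, u)]. *)
rewrite [X in (_ + X)%N](eq_bigl (fun D => orientation E D && ((v, u) \in D))).
  rewrite !big_orientation_arc -?eE // [[set v; u]]setUC -eE.
  (* The chosen arc moves into [A], ready for the induction hypothesis. *)
  under eq_bigr => D _ do rewrite setUCA setUA.
  under [X in (_ + X)%N]eq_bigr => D _ do rewrite setUCA setUA.
  rewrite !IH // (big_subset_setD1 _ _ _ _ Ee) -big_split /=.
  (* For each [X] avoiding [e], the claim is now [f_mod] at [A :|: edge_arcs X]. *)
  apply: eq_bigr => X _; rewrite eE edge_arcsU1 //.
  by rewrite !(setUCA A) -!setUA f_mod.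
move=> D /=; case oD: (orientation E D) => //=.
have := orientationP _ _ _ oD v u; rewrite Evu.
by case: (_ \in D) (_ \in D) => [] [].
Qed.

Theorem theorem4p8 (R : realType) (T : finType) (E : {set {set T}})
    (l : {set T} -> R) (s t : T) (d : R)
    (simpleE : simple_edges E)
    (l_ge0 : forall e, e \in E -> 0 <= l e) :
  #|[set D : {set T * T} |
      orientation E D && (dist l (arc_rel D) s t <= d%:E)%E]| =
  #|[set X : {set {set T}} |
      (X \subset E) && (dist l (edge_rel X) s t <= d%:E)%E]|.
Proof.
(* [l] is nonnegative only on [E], while the section asks for it everywhere; the absolute value
   agrees with [l] on [E]. *)
pose l' e := `|l e|.
have l'_ge0 e : 0 <= l' e by apply: normr_ge0.
have lE u v : [set u; v] \in E -> l [set u; v] = l' [set u; v].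
  by move=> /l_ge0/ger0_norm.
pose f D := (dist l' (arc_rel D) s t <= d%:E)%E.
have f_mod D u v := dist_le_arc_modular _ _ _ l'_ge0 D u v s t d.
rewrite !cardsE -!sum1_card !big_mkcondr /=.
transitivity (\sum_(D | orientation E D) f (set0 :|: D))%N.
  apply: eq_bigr => D /orientationP oD; rewrite set0U /f.
  rewrite (dist_eq _ _ l l' _ (arc_rel D)) //.
  (* Every arc of an orientation lies over an edge of [E]. *)
  move=> u v Duv; apply: lE; have := oD u v.
  by case: ifP => // _; rewrite [_ \in D]Duv.
rewrite (sum_orientations_subsets _ f) //; apply: eq_bigr => X /subsetP sXE.
rewrite set0U /f (dist_eq _ _ l l' (edge_rel X) (arc_rel (edge_arcs X))) //.
  by move=> u v; rewrite /edge_rel /arc_rel inE.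
by move=> u v /sXE/lE.
Qed.
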